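(* If the sequence $\left(\frac{O_d}{O_{d-1}}\right)_{d\geq 2}$ converges, then its limit is equal to $1$.
   Context: Binomial expansion: for positive integers $a,t$, there is a unique writing $a=\binom{k(t)}{t}+\binom{k(t-1)}{t-1}+\dots+\binom{k(j)}{j}$ with $k(t)>k(t-1)>\dots>k(j)\geq j\geq 1$; set $a^{\langle t\rangle}:=\binom{k(t)+1}{t+1}+\binom{k(t-1)+1}{t}+\dots+\binom{k(j)+1}{j+1}$, and $0^{\langle t\rangle}:=0$. An $O$-sequence is a sequence $h=(h_0,h_1,h_2,\dots)$ of non-negative integers with $h_0=1$ and $h_{t+1}\leq h_t^{\langle t\rangle}$ for every $t\geq 1$ (equivalently, the Hilbert function of a standard graded algebra over a field). It is finite if it has only finitely many non-zero values; it is then written $h=(h_0,\dots,h_s)$, where $s=\max\{t: h_t\neq 0\}$, and its multiplicity is $d=\sum_{t=0}^s h_t$. For every positive integer $d$, $O_d$ denotes the number of all finite $O$-sequences of multiplicity $d$. *)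

(* Defs.v *)
From HB Require Import structures.
From mathcomp Require Import all_boot all_order all_algebra finmap.
From mathcomp Require Import all_classical all_reals all_analysis.
Import Order.TTheory GRing.Theory Num.Theory.
Import numFieldNormedType.Exports.

Set Implicit Arguments.
Unset Strict Implicit.
Unset Printing Implicit Defensive.

Local Open Scope classical_set_scope.
Local Open Scope nat_scope.

(* [:: k(t); k(t-1); ...; k(j)] is stored in this order, so that the entry of
   index i is k(t - i) and j = t - size ks + 1. *)
Definition binomial_expansion (a t : nat) (ks : seq nat) : Prop :=
  [/\ 0 < size ks <= t,
      sorted gtn ks,
      (t - size ks).+1 <= last 0 ks
    & a = \sum_(i < size ks) 'C(nth 0 ks i, t - i)].

(* For a, t > 0 the expansion chosen by xget exists and is unique: see
   binomial_expansion_exists and binomial_expansion_unique. *)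
Definition macaulay (a t : nat) : nat :=
  if a == 0 then 0 else
  let ks := xget [::] [set ks | binomial_expansion a t ks] in
  \sum_(i < size ks) 'C((nth 0 ks i).+1, (t - i).+1).

Definition O_sequence (h : nat -> nat) : Prop :=
  h 0 = 1 /\ forall t, 1 <= t -> h t.+1 <= macaulay (h t) t.

(* Since h 0 = 1, h has finitely many non-zero values iff such an s exists. *)
Definition last_nonzero (h : nat -> nat) (s : nat) : Prop :=
  h s <> 0 /\ forall t, s < t -> h t = 0.

Definition finite_O_sequences (d : nat) : set (nat -> nat) :=
  [set h | O_sequence h /\
     exists2 s, last_nonzero h s & \sum_(0 <= t < s.+1) h t = d].

(* fset_set is meaningful here by finite_O_sequences_finite. *)
Definition numO (d : nat) : nat := #|` fset_set (finite_O_sequences d)|.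

Lemma binomial_expansion_cons a t k ks : ks != [::] ->
  binomial_expansion a t.+1 (k :: ks) <->
  [/\ head 0 ks < k, 'C(k, t.+1) <= a
    & binomial_expansion (a - 'C(k, t.+1)) t ks].
Proof.
case: ks => // k' ks _; rewrite /binomial_expansion /= big_ord_recl /=.
rewrite subn0 subSS !ltnS.
under eq_bigr => i _ do rewrite /bump leq0n add1n subSS.
split=> [[ht /andP[kk hs] hl ->]|[kk hC [ht hs hl hE]]].
  by rewrite leq_addr addKn.
by split=> //; [rewrite kk | rewrite -hE subnKC].
Qed.

Lemma binomial_expansion1 a t k :
  binomial_expansion a t.+1 [:: k] <-> t < k /\ a = 'C(k, t.+1).
Proof.
rewrite /binomial_expansion /= big_ord1 /= subn0 subSS subn0.
by split=> [[_ _ -> ->]|[-> ->]].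
Qed.

Lemma binomial_expansion_head a t ks : binomial_expansion a t ks ->
  [/\ t <= head 0 ks, 'C(head 0 ks, t) <= a & a < 'C((head 0 ks).+1, t)].
Proof.
elim: t a ks => [a [|k ks] [] // |t IH a [|k [|k' ks]]]; first by case.
  move=> /binomial_expansion1[tk ->] /=; split=> //.
  by rewrite binS -addn1 leq_add2l bin_gt0 ltnW.
move=> /binomial_expansion_cons => /(_ isT) /= [kk Ca /IH /= [tk' _ lt]].
split=> //; first exact: leq_ltn_trans kk.
by rewrite binS -ltn_subLR// (leq_trans lt)// leq_bin2l.
Qed.

Lemma binomial_expansion_exists a t : 0 < a -> 0 < t ->
  exists ks, binomial_expansion a t ks.
Proof.
case: t => // t a0 _; elim: t a a0 => [|t IH] a a0.
  by exists [:: a]; apply/binomial_expansion1; rewrite bin1.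
have exk : exists k, 'C(k, t.+2) <= a by exists 0.
have ubk k : 'C(k, t.+2) <= a -> k <= a + t.+2.
  apply: contraTT; rewrite -!ltnNge => lk.
  apply: leq_trans (leq_bin2l _ (ltnW lk)).
  elim: a {a0 exk lk} => [|a IHa]; first by rewrite add0n binn.
  rewrite addSn binS -addn1; apply: leq_add; first exact: IHa.
  by rewrite bin_gt0 ltnW// leq_addl.
case: (ex_maxnP exk ubk) => k Ck maxk.
have tk : t.+2 <= k by apply: maxk; rewrite binn.
have ltr : a - 'C(k, t.+2) < 'C(k, t.+1).
  rewrite ltn_subLR// -binS ltnNge; apply/negP => /maxk.
  by rewrite ltnn.
have [r0|r0] := posnP (a - 'C(k, t.+2)).
  exists [:: k]; apply/binomial_expansion1; split=> //.
  by apply/eqP; rewrite eqn_leq Ck -subn_eq0 r0.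
have [ks hks] := IH _ r0; exists (k :: ks).
have ks0 : ks != [::] by case: (ks) hks => // -[].
apply/binomial_expansion_cons => //; split=> //.
have [_ le _] := binomial_expansion_head hks.
rewrite ltnNge; apply/negP => kh.
by have := leq_ltn_trans (leq_trans (leq_bin2l t.+1 kh) le) ltr; rewrite ltnn.
Qed.

Lemma binomial_expansion_unique a t ks ks' :
  binomial_expansion a t ks -> binomial_expansion a t ks' -> ks = ks'.
Proof.
elim: t a ks ks' => [a [|k ks] ks' [] // |t IH a [|k ks] [|k' ks']].
- by [].
- by case.
- by move=> _ [].
move=> h h'.
have [/= tk le lt] := binomial_expansion_head h.
have [/= tk' le' lt'] := binomial_expansion_head h'.
have kk : k = k'.
  apply/eqP; rewrite eqn_leq; apply/andP; split; rewrite leqNgt; apply/negP => c.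
    by have := leq_ltn_trans (leq_trans (leq_bin2l t.+1 c) le) lt'; rewrite ltnn.
  by have := leq_ltn_trans (leq_trans (leq_bin2l t.+1 c) le') lt; rewrite ltnn.
subst k'; congr (_ :: _); clear - IH h h'.
have aux b l : 'C(k, t.+1) = b -> l != [::] ->
    ~ binomial_expansion b t.+1 (k :: l).
  move=> <- l0 /(binomial_expansion_cons _ _ _ l0)[_ _].
  rewrite subnn => e.
  have [tl le _] := binomial_expansion_head e.
  by move: le; rewrite leqNgt bin_gt0 tl.
case: ks h => [|x ks] h; case: ks' h' => [|y ks'] h' //.
- by move: h => /binomial_expansion1[_ /esym/aux-/(_ (y :: ks') isT)/(_ h')].
- by move: h' => /binomial_expansion1[_ /esym/aux-/(_ (x :: ks) isT)/(_ h)].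
have [_ _ e] := (binomial_expansion_cons a t k (ks := x :: ks) isT).1 h.
have [_ _ e'] := (binomial_expansion_cons a t k (ks := y :: ks') isT).1 h'.
exact: IH e e'.
Qed.

Lemma macaulayE a t ks : binomial_expansion a t ks ->
  macaulay a t = \sum_(i < size ks) 'C((nth 0 ks i).+1, (t - i).+1).
Proof.
move=> h; rewrite /macaulay.
have [th Ca _] := binomial_expansion_head h.
have -> : (a == 0) = false.
  by apply/negbTE; rewrite -lt0n (leq_trans _ Ca)// bin_gt0.
suff -> : xget [::] [set l | binomial_expansion a t l] = ks by [].
apply: (binomial_expansion_unique _ h).
have ex : exists l, [set l | binomial_expansion a t l] l by exists ks.
exact: (xgetPex [::] ex).
Qed.

Lemma finite_O_sequences_finite d : finite_set (finite_O_sequences d).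
Proof.
pose dec (f : {ffun 'I_d -> 'I_d.+1}) (t : nat) : nat :=
  if insub t is Some i then f i : nat else 0.
apply: (@sub_finite_set _ _ (dec @` setT)); last first.
  exact/finite_image/finite_finset.
move=> h [[h0 hS] [s [hs hs0] sumh]].
have pos t : t <= s -> 0 < h t.
  move=> ts; rewrite lt0n; apply/eqP => ht.
  suff : h s = 0 by [].
  rewrite -(subnKC ts); elim: (s - t) => [|n IH]; first by rewrite addn0.
  have tn : 1 <= t + n.
    by rewrite lt0n; apply/eqP => e; move: IH; rewrite e h0.
  by have := hS _ tn; rewrite IH /macaulay eqxx leqn0 addnS => /eqP.
have sd : s < d.
  rewrite -sumh -[s.+1]subn0 -[X in X <= _]muln1 -sum_nat_const_nat.
  by rewrite big_nat [X in _ <= X]big_nat; apply: leq_sum => i /andP[_ /pos].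
have hd t : h t <= d.
  have [ts|st] := leqP t s; last by rewrite hs0.
  by rewrite -sumh (bigD1_seq t) ?iota_uniq ?mem_index_iota//= leq_addr.
exists [ffun i : 'I_d => inord (h i)] => //.
apply/funext => t; rewrite /dec; case: insubP => [i _ <-|].
  by rewrite ffunE inordK// ltnS.
by rewrite -leqNgt => /(leq_trans sd)/hs0.
Qed.

(* Main.v *)
(** The sequence O_d grows subexponentially. As a^{<t>} = a whenever a <= t, an
O-sequence is non-increasing from the first t with h_t <= t, and since the
multiplicity bounds the sum of the h_t, such a t is smaller than m as soon as
d < m(m+1)/2. Hence h is determined by h_0, ..., h_(m-1) and by the conjugate
of the partition formed by its tail, whose parts are at most m, so that
O_d <= (d+1)^(2m). With d = n^2 and m = 2n this is n^O(n) and excludes a limit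
of the ratios larger than 1; a limit smaller than 1 is excluded by O_d >= 1. *)

Require Import Defs.
From mathcomp Require Import all_boot all_order all_algebra finmap zify lra.
From mathcomp Require Import all_classical all_reals all_analysis.
Import Order.TTheory GRing.Theory Num.Theory.
Import numFieldNormedType.Exports.

Local Open Scope classical_set_scope.
Local Open Scope ring_scope.
Local Open Scope nat_scope.

Set Implicit Arguments.
Unset Strict Implicit.
Unset Printing Implicit Defensive.

(** For [0 < a <= t] the expansion is C(t,t) + C(t-1,t-1) + ... with [a] terms, all equal to 1;
    raising both indices keeps each term 1. *)
Lemma macaulay_id (a t : nat) : a <= t -> macaulay a t = a.
Proof.
move=> at_; have [->|a0] := posnP a; first by rewrite /macaulay eqxx.
have E : binomial_expansion a t (mkseq (fun i => t - i) a).
  split; rewrite ?size_mkseq ?a0 //.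
  - apply/(sortedP 0) => i; rewrite size_mkseq => ia.
    by rewrite !nth_mkseq //=; lia.
  - rewrite -nth_last size_mkseq nth_mkseq; lia.
  - rewrite (eq_bigr (fun=> 1)) ?sum1_card ?card_ord // => i _.
    by rewrite nth_mkseq // binn.
rewrite (macaulayE E) size_mkseq (eq_bigr (fun=> 1)) ?sum1_card ?card_ord //.
move=> i _; rewrite nth_mkseq //.
exact: binn.
Qed.

(** * Shape of an O-sequence of multiplicity [d] *)

Section OSequence.
Variables (h : nat -> nat) (d : nat).
Hypothesis hO : finite_O_sequences d h.

(** The condition [h v <= v] propagates: there the Macaulay bound reads [h v.+1 <= h v]. *)
Lemma O_seq_nonincreasing T t u :
  h T <= T -> T <= t -> t <= u -> h u <= h t.
Proof.
move=> hT Tt tu; case: hO => -[h0 hS] _.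
have T0 : 0 < T by case: (T) hT => //; rewrite h0.
have step v : h v <= v -> T <= v -> h v.+1 <= h v.
  by move=> hv Tv; have := hS v (leq_trans T0 Tv); rewrite macaulay_id.
have le v : T <= v -> h v <= v.
  move=> /subnKC <-; elim: (v - T) => [|k IH]; first by rewrite addn0.
  by rewrite addnS (leq_trans (step _ IH _)) ?leq_addr // ltnW.
rewrite -(subnKC tu); elim: (u - t) => [|k IH]; first by rewrite addn0.
by rewrite addnS (leq_trans _ IH) // step ?le // (leq_trans Tt) ?leq_addr.
Qed.

Lemma O_seq_partial_sum n : \sum_(0 <= t < n) h t <= d.
Proof.
case: hO => _ [s [_ hs] <-].
have [ns|/ltnW sn] := leqP n s.+1.
  by rewrite [leqRHS](big_cat_nat (leq0n n) ns) //= leq_addr.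
rewrite (big_cat_nat (leq0n _) sn) //= -[leqRHS]addn0 leq_add2l.
by rewrite big_nat big1 // => t /andP[/hs].
Qed.

Lemma O_seq_le t : h t <= d.
Proof.
by apply: leq_trans (O_seq_partial_sum t.+1); rewrite big_nat_recr //= leq_addl.
Qed.

(** A zero persists, so [h t > 0] makes [h 0], ..., [h t] all positive, with sum at least [t.+1]. *)
Lemma O_seq_eq0 t : d <= t -> h t = 0.
Proof.
move=> dt; apply/eqP; rewrite -leqn0 leqNgt; apply/negP => ht.
have pos u : u <= t -> 0 < h u.
  move=> ut; rewrite lt0n; apply/eqP => hu.
  have := @O_seq_nonincreasing u u t.
  by rewrite hu leqn0 => /(_ isT (leqnn u) ut); rewrite eqn0Ngt ht.
suff : t.+1 <= d by lia.
apply: leq_trans (O_seq_partial_sum t.+1).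
rewrite -[leqLHS]subn0 -[leqLHS]muln1 -sum_nat_const_nat.
by rewrite big_nat [leqRHS]big_nat; apply: leq_sum => u /andP[_ /pos].
Qed.

(** Otherwise [h t >= t.+1] for all [t < m], and the sum is at least 1 + ... + m. *)
Lemma O_seq_small m : d < 'C(m.+1, 2) -> exists2 t, t < m & h t <= t.
Proof.
move=> dm.
have [/existsP[t ht]|] := boolP [exists t : 'I_m, h t <= t]; first by exists t.
rewrite negb_exists => /forallP hlt; move: dm; rewrite ltnNge => /negP[].
apply: leq_trans (O_seq_partial_sum m).
rewrite -bin2_sum !big_mkord big_ord_recl add0n.
by apply: leq_sum => t _; rewrite ltnNge hlt.
Qed.

End OSequence.

(* The conjugate of the partition h m >= h m.+1 >= ..., if h vanishes from m + d on *)
Definition tail_count (h : nat -> nat) (m d j : nat) : nat :=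
  \sum_(m <= t < m + d) (j < h t).

Lemma tail_count_le h m d j : tail_count h m d j <= d.
Proof.
rewrite -[leqRHS](addKn m) -[leqRHS]muln1 -sum_nat_const_nat.
by apply: leq_sum => t _; case: ltnP.
Qed.

(** By monotonicity the indices counted form an initial segment of the window, so their number
    locates its end. *)
Lemma tail_countP h m d j t : (forall u v, m <= u -> u <= v -> h v <= h u) ->
  m <= t -> t < m + d -> (j < h t) = (t < m + tail_count h m d j).
Proof.
move=> hmon mt td; rewrite /tail_count.
rewrite (big_cat_nat mt (ltnW td)) /= (big_cat_nat (leqnSn t) td) /= big_nat1.
set before := \sum_(m <= _ < t) _; set after := \sum_(t.+1 <= _ < _) _.
case: ltnP => ht.
  suff -> : before = t - m by lia.
  rewrite -[RHS]muln1 -sum_nat_const_nat; apply: eq_big_nat => u /andP[mu ut].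
  by rewrite (leq_trans ht) // hmon // ltnW.
suff -> : after = 0.
  suff : before <= t - m by lia.
  rewrite -[leqRHS]muln1 -sum_nat_const_nat.
  by apply: leq_sum => u _; case: ltnP.
rewrite /after big_nat big1 // => u /andP[tu _].
by rewrite ltnNge (leq_trans _ ht) // hmon // ltnW.
Qed.

(** * Upper and lower bounds on O_d *)

Lemma numO_le (d m : nat) : d < 'C(m.+1, 2) -> numO d <= d.+1 ^ (m + m).
Proof.
move=> dm; pose T := ({ffun 'I_m -> 'I_d.+1} * {ffun 'I_m -> 'I_d.+1})%type.
pose enc (h : nat -> nat) : T := ([ffun i : 'I_m => inord (h i)],
  [ffun j : 'I_m => inord (tail_count h m d j)]).
have enc_inj : {in fset_set (finite_O_sequences d) &, injective enc}.
  move=> h g; rewrite !in_fset_set ?inE; try exact: finite_O_sequences_finite.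
  move=> hO gO [/ffunP e1 /ffunP e2]; apply/funext => t.
  have mono f : finite_O_sequences d f ->
      f m <= m /\ forall u v, m <= u -> u <= v -> f v <= f u.
    move=> fO; have [s sm fs] := O_seq_small fO dm; split=> [|u v mu].
      apply: leq_trans (ltnW sm); apply: leq_trans (fs).
      exact: (O_seq_nonincreasing fO fs (leqnn s) (ltnW sm)).
    apply: (O_seq_nonincreasing fO fs).
    by rewrite (leq_trans (ltnW sm)).
  have [tm|mt] := ltnP t m.
    have := congr1 val (e1 (Ordinal tm)).
    by rewrite !ffunE /= !inordK // ltnS O_seq_le.
  have [dt|td] := leqP (m + d) t.
    by rewrite !(@O_seq_eq0 _ d) // (leq_trans _ dt) ?leq_addl.
  have [hm hmon] := mono h hO; have [gm gmon] := mono g gO.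
  (* The code records only [j < m]; for [j >= m] both sides are false, the tails being at most
     [m]. *)
  have E j : (j < h t) = (j < g t).
    have [jm|mj] := ltnP j m.
      rewrite (tail_countP j hmon mt td) (tail_countP j gmon mt td).
      have := congr1 val (e2 (Ordinal jm)).
      by rewrite !ffunE /= !inordK ?ltnS ?tail_count_le // => ->.
    rewrite !ltnNge !(leq_trans _ mj) //.
      exact: leq_trans (gmon _ _ (leqnn m) mt) gm.
    exact: leq_trans (hmon _ _ (leqnn m) mt) hm.
  by have := E (h t); have := E (g t); rewrite !ltnn; lia.
rewrite /numO -(card_in_imfset imfset_key enc_inj).
set A := imfset _ _ _.
have -> : d.+1 ^ (m + m) = #|{: T}|.
  by rewrite card_prod !card_ffun !card_ord expnD.
rewrite cardE; apply: uniq_leq_size; first exact: fset_uniq.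
by move=> x _; rewrite mem_enum.
Qed.

Lemma numO_gt0 (d : nat) : 0 < d -> 0 < numO d.
Proof.
case: d => // d _; rewrite cardfs_gt0; apply/fset0Pn.
(* The sequence (1, ..., 1) with as many ones as the multiplicity. *)
exists (fun t => (t < d.+1) : nat).
rewrite in_fset_set; last exact: finite_O_sequences_finite.
rewrite inE; split.
  split=> // t t1; rewrite macaulay_id; first by do 2![case: ltnP => //=]; lia.
  by case: ltnP.
exists d.
  by split=> [|t dt]; [rewrite ltnSn|rewrite ltnS leqNgt dt].
rewrite big_nat (eq_bigr (fun=> 1)) => [|t /andP[_ ->] //].
by rewrite -big_nat sum_nat_const_nat subn0 muln1.
Qed.

Local Open Scope ring_scope.

(** * Exponential against polynomial growth *)

Lemma bernoulli (R : realDomainType) (r : R) n : 0 <= r -> 1 + n%:R * r <= (1 + r) ^+ n.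
Proof.
move=> r0; elim: n => [|n IH]; first by rewrite mul0r addr0 expr0.
rewrite exprS; apply: le_trans (_ : (1 + r) * (1 + n%:R * r) <= _).
  rewrite -natr1; have : 0 <= n%:R * (r * r) by rewrite !mulr_ge0.
  lra.
by rewrite ler_wpM2l // addr_ge0.
Qed.

(** For n = (p+1)k, Bernoulli gives r^n >= (ke)^(p+1) with e = r - 1, of degree p+1 in k, while
    (n+2)^p <= ((p+3)k)^p has degree p. *)
Lemma polynomial_lt_exp (R : archiRealFieldType) (r : R) p N : 1 < r ->
  exists2 n, (N <= n)%N & (n.+2 ^ p)%:R < r ^+ n.
Proof.
move=> r1; set e := r - 1.
have e0 : 0 < e by rewrite subr_gt0.
have ep : 0 < e ^+ p.+1 by rewrite exprn_gt0.
pose c : R := (p + 3)%:R ^+ p.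
have [K hK] : exists K : nat, c / e ^+ p.+1 < K%:R.
  exists (Num.Def.archi_bound (c / e ^+ p.+1)).
  by apply: archi_boundP; rewrite divr_ge0 ?exprn_ge0 // ltW.
pose k := (K + N).+1; exists (p.+1 * k)%N; first by rewrite /k; nia.
have k0 : (0 : R) < k%:R by rewrite ltr0n.
apply: le_lt_trans (_ : ((p + 3) * k)%:R ^+ p < _).
  rewrite natrX lerXn2r ?nnegrE ?ler0n // ler_nat /k; nia.
rewrite natrM exprMn mulnC exprM.
apply: lt_le_trans (_ : (k%:R * e) ^+ p.+1 <= _).
  rewrite exprMn exprSr -/c mulrC -mulrA ltr_pM2l ?exprn_gt0 //.
  rewrite -ltr_pdivrMr //; apply: lt_le_trans hK _.
  by rewrite ler_nat /k; lia.
rewrite lerXn2r ?nnegrE ?mulr_ge0 ?exprn_ge0 ?ltW // ?(lt_trans ltr01) //.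
have := bernoulli k (ltW e0).
by rewrite /e subrKC; lra.
Qed.

Lemma geometric_ge (R : numDomainType) (a : nat -> R) r N : 0 <= r ->
  (forall n, (N <= n)%N -> r * a n <= a n.+1) ->
  forall k, r ^+ k * a N <= a (N + k)%N.
Proof.
move=> r0 ha; elim=> [|k IH]; first by rewrite expr0 mul1r addn0.
rewrite addnS; apply: le_trans (ha _ (leq_addr _ _)).
by rewrite exprS -mulrA ler_wpM2l.
Qed.

(** * Excluding limits other than 1 *)

Theorem corollary3p5 (R : realType) :
  let ratio := fun n : nat => (numO n.+2)%:R / (numO n.+1)%:R : R in
  cvg (ratio @ \oo) -> lim (ratio @ \oo) = 1.
Proof.
move=> ratio cv; set L := lim _.
pose a n : R := (numO n.+1)%:R.
have a1 n : 1 <= a n by rewrite ler1n numO_gt0.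
have a0 n : 0 < a n by apply: lt_le_trans (a1 n).
have cvL : ratio @ \oo --> L by [].
have [L1|L1|//] := ltgtP L 1.
- have [r Lr r1] : exists2 r, L < r & r < 1 by exists ((L + 1) / 2); lra.
  have [N _ hN] : \forall n \near \oo, ratio n < r.
    exact: (cvgr_lt _ cvL).
  have L0 : 0 <= L.
    by apply: limr_ge => //; near=> n; rewrite divr_ge0.
  have r0 : 0 < r by exact: le_lt_trans Lr.
  have ri1 : 1 < r^-1 by rewrite invf_gt1.
  (* The inverses of [a] would grow geometrically, although they are at most 1. *)
  have decay k : r^-1 ^+ k * (a N)^-1 <= (a (N + k)%N)^-1.
    apply: (@geometric_ge R (fun n => (a n)^-1)) => [|n Nn].
      by rewrite invr_ge0 ltW.
    rewrite -invfM lef_pV2 ?posrE ?mulr_gt0 //.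
    by rewrite -ler_pdivrMr // ltW // hN.
  have [k Nk] := polynomial_lt_exp 1 (numO N.+1) ri1.
  rewrite expn1 ltNge => /negP[].
  have : r^-1 ^+ k * (a N)^-1 <= 1 by rewrite (le_trans (decay k)) // invf_le1.
  by rewrite ler_pdivrMr // mul1r => /le_trans; apply; rewrite ler_nat; lia.
- have [r r1 rL] : exists2 r, 1 < r & r < L by exists ((L + 1) / 2); lra.
  have [N _ hN] : \forall n \near \oo, r < ratio n.
    exact: (cvgr_gt _ cvL).
  have r0 : 0 <= r by rewrite ltW // (lt_trans ltr01).
  have grow k : r ^+ k * a N <= a (N + k)%N.
    apply: geometric_ge => // m Nm.
    by rewrite -ler_pdivlMr // ltW // hN.
  (* The 8 arises from d = (n+1)^2 and m = 2(n+1): (d+1)^(2m) <= ((n+2)^2)^(4(n+1)). *)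
  have [n Nn hn] := polynomial_lt_exp 8 N r1.
  pose d := (n.+1 ^ 2)%N.
  have up : (numO d <= (n.+2 ^ 8) ^ n.+1)%N.
    apply: leq_trans (@numO_le d (2 * n.+1) _) _.
      rewrite bin2 /d; nia.
    rewrite (_ : 2 * n.+1 + 2 * n.+1 = 4 * n.+1)%N; last lia.
    rewrite (_ : 8 = 2 * 4)%N // !expnM !leq_exp2r // /d; nia.
  (* As N <= n, the exponent d - 1 - N = n^2 + 2n - N is at least n(n+1). *)
  have low : r ^+ n ^+ n.+1 <= a d.-1.
    have <- : (N + (d.-1 - N))%N = d.-1 by rewrite /d; nia.
    apply: le_trans (grow _); apply: le_trans (_ : r ^+ (d.-1 - N) <= _).
      by rewrite -exprM ler_weXn2l ?ltW // /d; nia.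
    by rewrite ler_peMr // exprn_ge0.
  (* Taking (n+1)-th roots contradicts the choice of [n]. *)
  suff : r ^+ n ^+ n.+1 <= (n.+2 ^ 8)%:R ^+ n.+1.
    rewrite ler_pXn2r ?nnegrE ?exprn_ge0 //.
    by rewrite leNgt hn.
  by apply: le_trans low _; rewrite /a prednK ?expn_gt0 // -natrX ler_nat.
Unshelve. all: by end_near.
Qed.
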